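(* (i) For all $m,n\in\mathbb Z$ and $f\in\mathcal A$, $$f(\gamma_m^{-1})=\widetilde B\bigl(f(\widetilde z),E_{\gamma_m}(z;\underline t;q)\bigr),\qquad f(x_n^{-1})=B\bigl(f(z),E_{x_n}(\widetilde z;\underline{\tilde t};q)\bigr).$$ In particular, $E_{\gamma_m}(x_n^{-1};\underline t;q)=E_{x_n}(\gamma_m^{-1};\underline{\tilde t};q)$ for all $m,n\in\mathbb Z$. (ii) For all $m,n\in\mathbb Z$ and all $f\in\mathcal A$ with $f(x)=f(x^{-1})$, $$f(\gamma_m)=\widetilde B\bigl(f(\widetilde z),E^+_{s(\gamma_m)}(z;\underline t;q)\bigr),\qquad f(x_n)=B\bigl(f(z),E^+_{s(x_n)}(\widetilde z;\underline{\tilde t};q)\bigr).$$ In particular, $E^+_{s(\gamma_m)}(x_n;\underline t;q)=E^+_{s(x_n)}(\gamma_m;\underline{\tilde t};q)$ for all $m,n\in\mathbb Z$.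
   Context: Parameters: $q\in\mathbb C\setminus\{0\}$ with $|q|\ne1$ and a fixed square root $q^{1/2}$; $\underline t=(k_0,k_1,u_0,u_1)$ nonzero complex numbers with $k_0^2,k_1^2,u_1^2\notin\{\pm q^j:j\in\mathbb Z\}$. The dual parameters are $\underline{\tilde t}=(u_1,k_1,u_0,k_0)$, i.e. $k_0$ and $u_1$ are interchanged. $\mathcal A=\mathbb C[x^{\pm1}]$. Define linear operators on $\mathcal A$ by $(T_1f)(x)=k_1f(x)+k_1^{-1}\frac{(1-k_1u_1x)(1+k_1u_1^{-1}x)}{1-x^2}\bigl(f(x^{-1})-f(x)\bigr)$ and $(T_0f)(x)=k_0f(x)+k_0^{-1}\frac{(1-q^{1/2}k_0u_0x^{-1})(1+q^{1/2}k_0u_0^{-1}x^{-1})}{1-qx^{-2}}\bigl(f(qx^{-1})-f(x)\bigr)$ (both invertible), $Y=T_1T_0$, $z=$ multiplication by $x$, and for $f\in\mathcal A$ let $f(z)$ be multiplication by $f$. The double affine Hecke algebra $\mathcal H(S;\underline t;q)$ is the subalgebra of $\mathrm{End}_{\mathbb C}(\mathcal A)$ generated by $T_0,T_1,z^{\pm1}$. Put $T_0^\vee=q^{-1/2}T_0^{-1}z$, $T_1^\vee=z^{-1}T_1^{-1}$. Objects with a tilde ($\widetilde T_i,\widetilde T_i^\vee,\widetilde Y,\widetilde z$) are the corresponding elements of $\mathcal H(S;\underline{\tilde t};q)$, built with $\underline{\tilde t}$ in place of $\underline t$. The duality anti-isomorphism $\nu_{\underline t,q}:\mathcal H(S;\underline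 t;q)\to\mathcal H(S;\underline{\tilde t};q)$ is the unique anti-algebra isomorphism with $T_0\mapsto\widetilde T_1^\vee$, $T_1\mapsto\widetilde T_1$, $T_0^\vee\mapsto\widetilde T_0^\vee$, $T_1^\vee\mapsto\widetilde T_0$; its inverse is $\nu_{\underline{\tilde t},q}$, and $\nu_{\underline t,q}(z)=\widetilde Y^{-1}$, $\nu_{\underline t,q}(Y)=\widetilde z^{-1}$. Evaluation maps: $\mathrm{Ev}_{\underline t,q}(X)=(X(1))(k_1^{-1}u_1^{-1})$ for $X\in\mathcal H(S;\underline t;q)$, and $\mathrm{Ev}_{\underline{\tilde t},q}(\widetilde X)=(\widetilde X(1))(k_1^{-1}k_0^{-1})$ for $\widetilde X\in\mathcal H(S;\underline{\tilde t};q)$. Bilinear pairings: $B(X,\widetilde X)=\mathrm{Ev}_{\underline t,q}\bigl(\nu_{\underline{\tilde t},q}(\widetilde X)X\bigr)$ and $\widetilde B(\widetilde X,X)=\mathrm{Ev}_{\underline{\tilde t},q}\bigl(\nu_{\underline t,q}(X)\widetilde X\bigr)$. Let $\epsilon(m)=1$ for $m\ge0$, $\epsilon(m)=-1$ for $m<0$, $\gamma_m=(k_0k_1)^{\epsilon(m)}q^m$ and $x_m=(k_1u_1)^{\epsilon(m)}q^m$. Order the monomials by $1\prec x^{-1}\prec x\prec x^{-2}\prec x^2\prec\cdots$. $P_m(\cdot;\underline t;q)$ ($m\in\mathbb Z$) is the unique Laurent polynomial $x^m+$ lower order terms w.r.t. $\preceq$ with $YP_m=\gamma_mP_m$; $P_m^+(\cdot;\underline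 t;q)$ ($m\ge0$) is the unique element of $\mathrm{span}\{P_m,P_{-m}\}$ of the form $x^m+$ lower order terms with $T_1P_m^+=k_1P_m^+$ (equivalently, invariant under $x\mapsto x^{-1}$). The polynomials with parameters $\underline{\tilde t}$ are defined likewise (the eigenvalues of $\widetilde Y$ are the $x_m$). It is assumed that $P_m(x_0^{-1};\underline t;q)$, $P_m(\gamma_0^{-1};\underline{\tilde t};q)$ ($m\in\mathbb Z$) and $P_m^+(x_0;\underline t;q)$, $P_m^+(\gamma_0;\underline{\tilde t};q)$ ($m\ge0$) are all nonzero. With $s(\gamma)=\gamma+\gamma^{-1}$, the renormalized polynomials are $E_{\gamma_m}(x;\underline t;q)=P_m(x;\underline t;q)/P_m(x_0^{-1};\underline t;q)$ and $E_{x_m}(x;\underline{\tilde t};q)=P_m(x;\underline{\tilde t};q)/P_m(\gamma_0^{-1};\underline{\tilde t};q)$ for $m\in\mathbb Z$; $E^+_{s(\gamma_m)}(x;\underline t;q)=P^+_m(x;\underline t;q)/P_m^+(x_0;\underline t;q)$ and $E^+_{s(x_m)}(x;\underline{\tilde t};q)=P^+_m(x;\underline{\tilde t};q)/P_m^+(\gamma_0;\underline{\tilde t};q)$ for $m\ge0$. Since $s(\gamma_{-m})=s(\gamma_m)$ and $s(x_{-m})=s(x_m)$, the symmetric ones are indexed by all $m\in\mathbb Z$. *)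

(* Defs.v *)
From HB Require Import structures.
From mathcomp Require Import all_boot all_order all_algebra.
From mathcomp Require Import finmap monalg complex.
From mathcomp Require Import boolp classical_sets functions reals.

Set Implicit Arguments.
Unset Strict Implicit.
Unset Printing Implicit Defensive.

Import Order.TTheory GRing.Theory Num.Theory.

Local Open Scope fset_scope.
Local Open Scope ring_scope.

(* monalg's ring structure on [{malg F[K]}] requires a monoid of exponents
   without nontrivial units, which excludes [int]; hence the alias, which keeps
   the module structure of [{malg F[int]}] and carries the convolution
   product. *)
Definition laurent (F : fieldType) : Type := {malg F[int]}.

HB.instance Definition _ (F : fieldType) := GRing.Lmodule.on (laurent F).

Section LaurentRing.
Variable F : fieldType.
Implicit Types f g h : laurent F.

Definition lmon (m : int) : laurent F := << 1 *g m >>.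

Definition lmul f g : laurent F :=
  \sum_(i <- msupp f) \sum_(j <- msupp g) << f@_i * g@_j *g i + j >>.

Lemma lmulEw (d1 d2 : {fset int}) f g :
  msupp f `<=` d1 -> msupp g `<=` d2 ->
  lmul f g = \sum_(i <- d1) \sum_(j <- d2) << f@_i * g@_j *g i + j >>.
Proof.
move=> le1 le2; rewrite /lmul (big_fset_incl _ le1) /=.
  apply/eq_bigr=> i _; apply/big_fset_incl => // j _ /mcoeff_outdom ->.
  by rewrite mulr0 monalgU0.
move=> i _ /mcoeff_outdom fi.
by rewrite big1 // => j _; rewrite fi mul0r monalgU0.
Qed.

Lemma lmulC : commutative lmul.
Proof.
move=> f g; rewrite /lmul exchange_big /=.
by apply/eq_bigr=> i _; apply/eq_bigr=> j _; rewrite mulrC addrC.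
Qed.

Lemma lmul0l : left_zero 0 lmul.
Proof. by move=> g; rewrite /lmul msupp0 big_seq_fset0. Qed.

Lemma lmulDl : left_distributive lmul +%R.
Proof.
move=> f1 f2 g.
rewrite (@lmulEw (msupp f1 `|` msupp f2) (msupp g)) ?msuppD_le //.
rewrite (@lmulEw (msupp f1 `|` msupp f2) (msupp g) f1) ?fsubsetUl //.
rewrite (@lmulEw (msupp f1 `|` msupp f2) (msupp g) f2) ?fsubsetUr //.
rewrite -big_split /=; apply/eq_bigr=> i _.
rewrite -big_split /=; apply/eq_bigr=> j _.
by rewrite mcoeffD mulrDl monalgUD.
Qed.

Lemma lmulDr : right_distributive lmul +%R.
Proof. by move=> f g h; rewrite lmulC lmulDl !(lmulC f). Qed.

Lemma lmulUU (a b : F) (i j : int) :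
  lmul << a *g i >> << b *g j >> = << a * b *g i + j >>.
Proof.
rewrite (@lmulEw [fset i] [fset j]) ?msuppU_le //.
by rewrite !big_seq_fset1 !mcoeffUU.
Qed.

Lemma lmulEl f g : lmul f g = \sum_(i <- msupp f) lmul << f@_i *g i >> g.
Proof.
apply/eq_bigr=> i _.
rewrite (@lmulEw [fset i] (msupp g)) ?msuppU_le //.
by rewrite big_seq_fset1; apply/eq_bigr=> j _; rewrite mcoeffUU.
Qed.

Lemma lmulEr f g : lmul f g = \sum_(j <- msupp g) lmul f << g@_j *g j >>.
Proof. by rewrite lmulC lmulEl; apply/eq_bigr=> j _; rewrite lmulC. Qed.

Lemma lmulA : associative lmul.
Proof.
move=> f g h.
have lmul0r : right_zero 0 lmul by move=> u; rewrite lmulC lmul0l.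
have lmul_suml u (r : seq int) (G : int -> laurent F) :
    lmul (\sum_(i <- r) G i) u = \sum_(i <- r) lmul (G i) u.
  exact: (big_morph (lmul^~ u) (fun _ _ => lmulDl _ _ _) (lmul0l u)).
have lmul_sumr u (r : seq int) (G : int -> laurent F) :
    lmul u (\sum_(i <- r) G i) = \sum_(i <- r) lmul u (G i).
  exact: (big_morph (lmul u) (fun _ _ => lmulDr _ _ _) (lmul0r u)).
rewrite (lmulEl f g) lmul_suml (lmulEl f); apply/eq_bigr=> i _.
rewrite (lmulEl g h) lmul_sumr (lmulEr _ g) lmul_suml; apply/eq_bigr=> j _.
rewrite (lmulEr _ h) lmul_sumr (lmulEr _ h); apply/eq_bigr=> k _.
by rewrite !lmulUU mulrA addrA.
Qed.

Lemma lmul1l : left_id (lmon 0) lmul.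
Proof.
move=> g; rewrite (@lmulEw [fset 0] (msupp g)) ?msuppU_le //.
rewrite big_seq_fset1 [RHS]monalgE.
by apply/eq_bigr=> j _; rewrite mcoeffUU mul1r add0r.
Qed.

Lemma lmon0_neq0 : lmon 0 != 0.
Proof. by rewrite monalgU_eq0 oner_eq0. Qed.

HB.instance Definition _ := GRing.Zmodule_isComNzRing.Build (laurent F)
  lmulA lmulC lmul1l lmulDl lmon0_neq0.

Lemma lscaleAl (a : F) f g : a *: (f * g) = (a *: f) * g.
Proof.
have lscaleE u : a *: u = lmul << a *g 0 >> u.
  rewrite (@lmulEw [fset 0] (msupp u)) ?msuppU_le // big_seq_fset1.
  rewrite /GRing.scale /= /fgscale.
  by apply/eq_bigr=> j _; rewrite mcoeffUU add0r.
by rewrite !lscaleE; exact: lmulA.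
Qed.

HB.instance Definition _ :=
  GRing.Lmodule_isLalgebra.Build F (laurent F) lscaleAl.
HB.instance Definition _ :=
  GRing.Lalgebra_isComAlgebra.Build F (laurent F).

(* Meaningful for [c != 0] only. *)
Definition leval f (c : F) : F := \sum_(i <- msupp f) f@_i * c ^ i.

(* [lrefl a f] is f(a x^-1). *)
Definition lrefl (a : F) f : laurent F :=
  \sum_(i <- msupp f) << f@_i * a ^ i *g - i >>.

Definition lsymmetric f : Prop := lrefl 1 f = f.

Definition opinv (X : laurent F -> laurent F) : laurent F -> laurent F :=
  'pinv_(fun=> 0) setT X.

(* The quotient g / d in C(x), when it is a Laurent polynomial. *)
Definition lquo g d : laurent F := opinv ( *%R d) g.

(* 1 < x^-1 < x < x^-2 < x^2 < ... *)
Definition lrank (m : int) : nat :=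
  if 0 <= m then (2 * `|m|)%N else (2 * `|m|).-1.

Definition lmonic_of (m : int) f : Prop :=
  f@_m = 1 /\ forall n : int, (lrank m < lrank n)%N -> f@_n = 0.

Definition renorm (c : F) f : laurent F := (leval f c)^-1 *: f.

End LaurentRing.

Record params (F : Type) := Params { k0 : F; k1 : F; u0 : F; u1 : F }.

Definition dual (F : Type) (t : params F) : params F :=
  Params (u1 t) (k1 t) (u0 t) (k0 t).

Section Daha.
Variable F : fieldType.
(* [s] plays the role of the fixed square root of [q]. *)
Variables (q s : F).
Implicit Types (t : params F) (f : laurent F).

Local Notation op := (laurent F -> laurent F).

Definition generic t : Prop :=
  [/\ k0 t != 0, k1 t != 0, u0 t != 0 & u1 t != 0] /\
  forall j : int,
    [/\ k0 t ^+ 2 != q ^ j, k1 t ^+ 2 != q ^ j & u1 t ^+ 2 != q ^ j] /\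
    [/\ k0 t ^+ 2 != - q ^ j, k1 t ^+ 2 != - q ^ j & u1 t ^+ 2 != - q ^ j].

Local Notation x := (lmon F 1).
Local Notation xV := (lmon F (-1)).

Definition T1 t : op := fun f =>
  k1 t *: f +
  (k1 t)^-1 *:
    ((1 - (k1 t * u1 t) *: x) * (1 + (k1 t * (u1 t)^-1) *: x) *
     lquo (lrefl 1 f - f) (1 - x ^+ 2)).

Definition T0 t : op := fun f =>
  k0 t *: f +
  (k0 t)^-1 *:
    ((1 - (s * k0 t * u0 t) *: xV) * (1 + (s * k0 t * (u0 t)^-1) *: xV) *
     lquo (lrefl q f - f) (1 - q *: xV ^+ 2)).

Definition Y t : op := T1 t \o T0 t.

(* f(z), multiplication by f *)
Definition mulop f : op := fun g => f * g.

Definition z : op := mulop x.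
Definition zV : op := mulop xV.

Definition T0v t : op := fun f => s^-1 *: opinv (T0 t) (z f).
Definition T1v t : op := zV \o opinv (T1 t).

Inductive hecke t : set op :=
| hecke_T0 : hecke t (T0 t)
| hecke_T1 : hecke t (T1 t)
| hecke_z : hecke t z
| hecke_zV : hecke t zV
| hecke_id : hecke t idfun
| hecke_add (X X' : op) : hecke t X -> hecke t X' -> hecke t (X \+ X')
| hecke_scale (a : F) (X : op) : hecke t X -> hecke t (a \*: X)
| hecke_comp (X X' : op) : hecke t X -> hecke t X' -> hecke t (X \o X').

(* Only the values of [nu] on [hecke t] matter. *)
Definition duality_antiiso t (nu : op -> op) : Prop :=
  [/\ set_bij (hecke t) (hecke (dual t)) nu,
      forall X X', hecke t X -> hecke t X' -> nu (X \+ X') = nu X \+ nu X',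
      forall a X, hecke t X -> nu (a \*: X) = a \*: nu X,
      nu idfun = idfun
    & forall X X', hecke t X -> hecke t X' -> nu (X \o X') = nu X' \o nu X] /\
  [/\ nu (T0 t) = T1v (dual t),
      nu (T1 t) = T1 (dual t),
      nu (T0v t) = T0v (dual t)
    & nu (T1v t) = T0 (dual t)].

Definition Ev t (X : op) : F := leval (X 1) ((k1 t)^-1 * (u1 t)^-1).

(* With [nu'] the duality anti-isomorphism of [dual t], [pairing t nu'] is B;
   with [nu] that of [t], [pairing (dual t) nu] is B tilde, because
   [dual (dual t)] is [t]. *)
Definition pairing t (nu' : op -> op) (X X' : op) : F := Ev t (nu' X' \o X).

Definition eps (m : int) : int := if 0 <= m then 1 else -1.
Definition gammap t (m : int) : F := (k0 t * k1 t) ^ eps m * q ^ m.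
Definition xp t (m : int) : F := (k1 t * u1 t) ^ eps m * q ^ m.

Definition is_P t (m : int) (p : laurent F) : Prop :=
  lmonic_of m p /\ Y t p = gammap t m *: p.

(* The second argument is the family of the nonsymmetric polynomials. *)
Definition is_Pplus t (P : int -> laurent F) (m : nat) (p : laurent F) : Prop :=
  [/\ exists a b : F, p = a *: P m%:Z + b *: P (- m%:Z),
      lmonic_of m%:Z p
    & T1 t p = k1 t *: p].

End Daha.

(* Main.v *)
(** The operators T_0, T_1 have the form k + k^-1 N D, where D f = (s f - f)/d
    is a divided difference for a reflection s. It follows that
    T_i g(z) = (s_i g)(z) T_i + h(z), so the Hecke algebra is spanned by the
    products g(z) W with W a word in T_0, T_1. On such products Ev of X and Ev~
    of nu(X) agree: T_0 and T_1 act on 1 by the scalars k_0 and k_1, dually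
    T_1^v~ and T_1~ act by the same scalars on values at the point where Ev~
    evaluates, and nu(g(z)) = g(Y~^-1) acts on 1 by g(x_0^-1). Hence
    Ev~ (nu X) = Ev X for all X, and

      B~(f(z~), p(z)) = Ev~ (nu (p(z)) f(z~)) = Ev (f(Y^-1) p(z)),

    whose right side is f(gamma_m^-1) p(x_0^-1) if Y p = gamma_m p. Reading the
    middle term as p(Y~^-1) applied to f gives the duality when f is itself an
    eigenvector of Y~. For symmetric f, f(Y^-1) acts by a scalar on
    span(P_m, P_-m), because the two eigenvalues are inverse to each other. *)
Require Import Defs.
From HB Require Import structures.
From mathcomp Require Import all_boot all_order all_algebra.
From mathcomp Require Import finmap monalg complex ring.
From mathcomp Require Import boolp classical_sets functions reals.

Set Implicit Arguments.
Unset Strict Implicit.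
Unset Printing Implicit Defensive.

Import Order.TTheory GRing.Theory Num.Theory.

Local Open Scope ring_scope.

(** * Laurent polynomials *)
Section Laurent.
Variable F : fieldType.
Implicit Types (f g h : laurent F) (a c : F) (m n : int).

Local Notation x := (lmon F 1).
Local Notation xV := (lmon F (-1)).

Lemma lmonD m n : lmon F (m + n) = lmon F m * lmon F n.
Proof. by rewrite /lmon [RHS]lmulUU mulr1. Qed.

Lemma lmon0 : lmon F 0 = 1.
Proof. by []. Qed.

Lemma lmon_xV : x * xV = 1.
Proof. by rewrite -lmonD subrr. Qed.

Lemma lscaleU a m : << a *g m >> = a *: lmon F m.
Proof. by apply/malgP => k; rewrite mcoeffZ !mcoeffU mulrnAr mulr1. Qed.

Lemma lscaleE a f : a *: f = a%:A * f.
Proof. by rewrite -scalerAl mul1r. Qed.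

Lemma lconstM a c : (a * c)%:A = a%:A * c%:A :> laurent F.
Proof. by rewrite -lscaleE scalerA. Qed.

Lemma linear_scale (X : laurent F -> laurent F) a f :
  linear X -> X (a *: f) = a *: X f.
Proof. by move=> lX; exact: (GRing.scalable_linear lX). Qed.

Lemma laurent_lin_ind (Q : laurent F -> Prop) :
  (forall m, Q (lmon F m)) -> (forall a f, Q f -> Q (a *: f)) ->
  (forall f g, Q f -> Q g -> Q (f + g)) -> forall f, Q f.
Proof.
move=> Qm QZ QD f; rewrite (monalgE f).
apply: (big_ind Q) => // [|i _]; last by rewrite lscaleU; apply: QZ.
by rewrite -[0](scale0r (lmon F 0)); apply: QZ.
Qed.

(** Since x x^-1 = 1, the two generators already reach every monomial, constants included.
    Divisibility by [d], membership in the Hecke algebra and the images under [nu] are all checked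
    this way. *)
Lemma laurent_alg_ind (Q : laurent F -> Prop) :
  Q x -> Q xV -> (forall a f, Q f -> Q (a *: f)) ->
  (forall f g, Q f -> Q g -> Q (f + g)) ->
  (forall f g, Q f -> Q g -> Q (f * g)) -> forall f, Q f.
Proof.
move=> Qx QxV QZ QD QM; apply: laurent_lin_ind => //.
have Q1 : Q 1 by rewrite -lmon_xV; apply: QM.
case=> n; last rewrite NegzE.
  elim: n => [|n IHn]; first by rewrite lmon0.
  by rewrite -addn1 PoszD lmonD; apply: QM.
elim: n => [//|n IHn].
by rewrite -addn1 PoszD opprD lmonD; apply: QM.
Qed.

Section LinearExtension.
Variables (V : lmodType F) (h : int -> V).

(** Evaluation and reflection are both of this form, which is where their linearity comes from. *)
Definition lext f : V := \sum_(i <- msupp f) f@_i *: h i.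

Lemma lext_is_linear : linear lext.
Proof.
(* The three supports differ, so the sums are first extended by zero coefficients to one common
   index set. *)
move=> a f g; pose d := (msupp f `|` msupp g `|` msupp (a *: f + g))%fset.
have lextE u : (msupp u `<=` d)%fset -> lext u = \sum_(i <- d) u@_i *: h i.
  move=> le_ud; apply: big_fset_incl => // i _ /mcoeff_outdom ->.
  by rewrite scale0r.
rewrite !lextE;
  try by apply/fsubsetP => i; rewrite !in_fsetU => ->; rewrite ?orbT.
rewrite scaler_sumr -big_split /=; apply: eq_bigr => i _.
by rewrite mcoeffD mcoeffZ scalerDl scalerA.
Qed.

Lemma lext_mon m : lext (lmon F m) = h m.
Proof. by rewrite /lext msuppU oner_eq0 big_seq_fset1 mcoeffUU scale1r. Qed.

End LinearExtension.

Lemma lreflE a : lrefl a = lext (fun i => a ^ i *: lmon F (- i)).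
Proof.
by apply/funext => f; apply: eq_bigr => i _; rewrite lscaleU scalerA.
Qed.

Lemma levalP c a f g : leval (a *: f + g) c = a * leval f c + leval g c.
Proof. exact: (lext_is_linear (fun i => c ^ i : F^o)). Qed.

Lemma levalD c f g : leval (f + g) c = leval f c + leval g c.
Proof. by rewrite -[f]scale1r levalP mul1r scale1r. Qed.

Lemma levalZ c a f : leval (a *: f) c = a * leval f c.
Proof.
exact: (GRing.scalable_linear (lext_is_linear (fun i => c ^ i : F^o))).
Qed.

Lemma leval_mon c m : leval (lmon F m) c = c ^ m.
Proof. by exact: (lext_mon (fun i => c ^ i : F^o)). Qed.

Lemma leval1 c : leval (1 : laurent F) c = 1.
Proof. by rewrite -lmon0 leval_mon expr0z. Qed.

Lemma levalM c f g : c != 0 -> leval (f * g) c = leval f c * leval g c.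
Proof.
move=> c0; elim/laurent_lin_ind: f => [m|a f IHf|f1 f2 IH1 IH2].
- elim/laurent_lin_ind: g => [n|a g IHg|g1 g2 IH1 IH2].
  + by rewrite -lmonD !leval_mon expfzDr.
  + by rewrite -scalerAr !levalZ IHg mulrCA.
  + by rewrite mulrDr !levalD IH1 IH2 mulrDr.
- by rewrite -scalerAl !levalZ IHf mulrA.
- by rewrite mulrDl !levalD IH1 IH2 mulrDl.
Qed.

Lemma lrefl_is_linear a : linear (lrefl a).
Proof. by rewrite lreflE; apply: lext_is_linear. Qed.

HB.instance Definition _ a := GRing.isLinear.Build F (laurent F) (laurent F) _
  (lrefl a) (lrefl_is_linear a).

Lemma lrefl_mon a m : lrefl a (lmon F m) = a ^ m *: lmon F (- m).
Proof. by rewrite lreflE lext_mon. Qed.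

Lemma lreflM a : a != 0 -> {morph lrefl a : f g / f * g}.
Proof.
move=> a0 f g; elim/laurent_lin_ind: f => [m|c f IHf|f1 f2 IH1 IH2].
- elim/laurent_lin_ind: g => [n|c g IHg|g1 g2 IH1 IH2].
  + rewrite -lmonD !lrefl_mon opprD lmonD expfzDr //.
    by rewrite -scalerAl -scalerAr scalerA.
  + by rewrite -scalerAr !linearZ /= IHg scalerAr.
  + by rewrite mulrDr !linearD /= IH1 IH2 mulrDr.
- by rewrite -scalerAl !linearZ /= IHf scalerAl.
- by rewrite mulrDl !linearD /= IH1 IH2 mulrDl.
Qed.

Lemma lreflK a : a != 0 -> involutive (lrefl a).
Proof.
move=> a0; elim/laurent_lin_ind => [m|c f IHf|f1 f2 IH1 IH2].
- rewrite lrefl_mon linearZ /= lrefl_mon scalerA opprK -expfzDr //.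
  by rewrite subrr expr0z scale1r.
- by rewrite !linearZ /= IHf.
- by rewrite !linearD /= IH1 IH2.
Qed.

Lemma leval_lrefl1 f c : leval (lrefl 1 f) c = leval f c^-1.
Proof.
elim/laurent_lin_ind: f => [m|a f IHf|f1 f2 IH1 IH2].
- by rewrite lrefl_mon exp1rz scale1r !leval_mon exprz_inv.
- by rewrite linearZ /= !levalZ IHf.
- by rewrite linearD /= !levalD IH1 IH2.
Qed.

Lemma leval_lsymmetric f c : lsymmetric f -> leval f c^-1 = leval f c.
Proof. by rewrite /lsymmetric => sf; rewrite -leval_lrefl1 sf. Qed.

Lemma mcoeff_lmonM m f k : (lmon F m * f)@_k = f@_(k - m).
Proof.
elim/laurent_lin_ind: f => [n|a f IHf|f1 f2 IH1 IH2].
- by rewrite -lmonD !mcoeffU (eq_sym n) subr_eq (addrC n) eq_sym.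
- by rewrite -scalerAr !mcoeffZ IHf.
- by rewrite mulrDr !mcoeffD IH1 IH2.
Qed.

(* A nonzero solution of [h = a *: (lmon m * h)] would have infinite support. *)
Lemma lmonB1_mul_eq0 a m h : m != 0 -> (1 - a *: lmon F m) * h = 0 -> h = 0.
Proof.
move=> m0 h0.
have hE k : h@_k = a * h@_(k - m).
  have {1}-> : h = a *: (lmon F m * h).
    by apply/subr0_eq; rewrite scalerAl -{1}[h]mul1r -mulrBl.
  by rewrite mcoeffZ mcoeff_lmonM.
apply/malgP => j; rewrite mcoeff0; apply/eqP/negPn/negP => hj.
have sub (n : nat) : j - m *+ n \in msupp h.
  rewrite -mcoeff_neq0; elim: n => [|n]; first by rewrite mulr0n subr0.
  rewrite hE mulf_eq0 negb_or => /andP[_].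
  by rewrite mulrSr opprD addrA.
pose r := [seq j - m *+ i | i <- iota 0 (size (msupp h)).+1].
have : (size r <= size (msupp h))%N.
  apply: uniq_leq_size; last by move=> _ /mapP[n _ ->].
  by rewrite map_inj_uniq ?iota_uniq // => n1 n2 /addrI /oppr_inj /(mulrIn m0).
by rewrite size_map size_iota ltnn.
Qed.

Lemma lmonB1_reg a m : m != 0 -> injective ( *%R (1 - a *: lmon F m)).
Proof.
move=> m0 f g fgE; apply/subr0_eq/(lmonB1_mul_eq0 (a := a) m0).
by rewrite mulrBr fgE subrr.
Qed.

Lemma opinvE (X X' : laurent F -> laurent F) :
  cancel X X' -> cancel X' X -> opinv X = X'.
Proof.
move=> XK X'K; apply/funext => f; apply: (can_inj XK).
by rewrite X'K /opinv pinvK // inE /=; exists (X' f).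
Qed.

(** [lquo] is a chosen preimage; injectivity leaves only one to choose. *)
Lemma lquoP d g h : injective ( *%R d) -> d * h = g -> lquo g d = h.
Proof.
by move=> d_inj <-; rewrite /lquo /opinv pinvKV ?in_setT // => ? ? _ _ /d_inj.
Qed.

End Laurent.

(** * Demazure-Lusztig operators *)
(** What [T0] and [T1] share: a reflection [sg], a denominator [d] and a numerator [N]. For d = 1 -
    w^2 with [sg] inverting w, [dem_refl_den] reads (1 - w^-2) w^2 = w^2 - 1. [dem_num] is the
    condition on [N] behind the relation (T - k)(T + k^-1) = 0. *)
Record demazure_datum (F : fieldType) (sg : {linear laurent F -> laurent F})
    (d N : laurent F) (k : F) : Prop := DemazureDatum {
  dem_reflM : {morph sg : f g / f * g};
  dem_reflK : involutive sg;
  dem_reg : injective ( *%R d);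
  dem_dvd_x : exists h, d * h = sg (lmon F 1) - lmon F 1;
  dem_dvd_xV : exists h, d * h = sg (lmon F (-1)) - lmon F (-1);
  dem_refl_den : sg d * (1 - d) = - d;
  dem_num : sg N - N = d * (sg N - (1 + k ^+ 2)%:A);
  dem_k : k != 0
}.

Section DemazureLusztig.
Variables (F : fieldType) (sg : {linear laurent F -> laurent F}).
Variables (d N : laurent F) (k : F).
Implicit Types f g h : laurent F.

Definition ddiff f : laurent F := lquo (sg f - f) d.

Definition dlop f : laurent F := k *: f + k^-1 *: (N * ddiff f).

(** The quadratic relation forces T^-1 = T - (k - k^-1). *)
Definition dlinv f : laurent F := dlop f - (k - k^-1) *: f.

Hypothesis H : demazure_datum sg d N k.

Let d_inj := dem_reg H.
Let sgM := dem_reflM H.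

Let sgZ a f : sg (a *: f) = a *: sg f. Proof. exact: linearZZ. Qed.
Let sgD f g : sg (f + g) = sg f + sg g. Proof. exact: linearD. Qed.
Let sgB f g : sg (f - g) = sg f - sg g. Proof. exact: linearB. Qed.

(** Divisibility passes to products because s(f g) - f g = s(f) (s(g) - g) + (s(f) - f) g, so the
    generators x and x^-1 suffice. *)
Lemma ddiffE f : d * ddiff f = sg f - f.
Proof.
suff [h hE] : exists h, d * h = sg f - f by rewrite /ddiff (lquoP d_inj hE).
elim/laurent_alg_ind: f => [||a f [h hE]|f g [h hE] [l lE]|f g [h hE] [l lE]].
- exact: dem_dvd_x H.
- exact: dem_dvd_xV H.
- by exists (a *: h); rewrite -scalerAr hE scalerBr sgZ.
- by exists (h + l); rewrite mulrDr hE lE sgD opprD addrACA.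
- exists (sg f * l + h * g).
  by rewrite mulrDr mulrCA lE (mulrA d) hE sgM; ring.
Qed.

Lemma ddiff_linear : linear ddiff.
Proof.
move=> a f g; apply: d_inj.
rewrite mulrDr -scalerAr !ddiffE linearP /= scalerBr opprD !addrA.
by rewrite -!addrA; congr (_ + _); rewrite addrCA.
Qed.

Lemma ddiffM f g : ddiff (f * g) = sg f * ddiff g + ddiff f * g.
Proof.
by apply: d_inj; rewrite mulrDr mulrCA (mulrA d) !ddiffE sgM; ring.
Qed.

(** Applying s = [sg] to d D f = s f - f changes the sign. With [dem_refl_den] this gives s(D f) =
    (1 - d) D f, hence d D(D f) = - d D f. *)
Lemma ddiff_idem f : ddiff (ddiff f) = - ddiff f.
Proof.
have sgd : sg (ddiff f) * sg d = - (d * ddiff f).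
  by rewrite -sgM mulrC ddiffE sgB (dem_reflK H) opprB.
have sg_ddiff : sg (ddiff f) = (1 - d) * ddiff f.
  apply: d_inj => /=; apply: oppr_inj.
  transitivity (sg (ddiff f) * sg d * (1 - d)); last by rewrite sgd; ring.
  by rewrite -mulrA (dem_refl_den H); ring.
by apply: d_inj; rewrite ddiffE sg_ddiff; ring.
Qed.

Lemma ddiff1 : ddiff 1 = 0.
Proof.
have sg1 : sg 1 = 1.
  by have := sgM 1 (sg 1); rewrite mul1r (dem_reflK H) mulr1.
by apply: d_inj; rewrite ddiffE mulr0 sg1 subrr.
Qed.

(** Scalars become constant polynomials so that [ring] sees scaling as multiplication. *)
Let C a : laurent F := a%:A.

Let scaleC a f : a *: f = C a * f. Proof. exact: lscaleE. Qed.

Let CD a b : C (a + b) = C a + C b. Proof. exact: scalerDl. Qed.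
Let CB a b : C (a - b) = C a - C b. Proof. exact: scalerBl. Qed.
Let CM a b : C (a * b) = C a * C b. Proof. exact: lconstM. Qed.
Let C1 : C 1 = 1. Proof. exact: scale1r. Qed.

Let kK : C k * C k^-1 = 1.
Proof. by rewrite -CM mulfV ?C1 ?(dem_k H). Qed.

Lemma dlop_linear : linear dlop.
Proof.
move=> a f g; rewrite /dlop ddiff_linear !scaleC; ring.
Qed.

Lemma dlopD f g : dlop (f + g) = dlop f + dlop g.
Proof. by rewrite -[f]scale1r dlop_linear !scale1r. Qed.

Lemma dlopZ a f : dlop (a *: f) = a *: dlop f.
Proof. exact: (linear_scale _ _ dlop_linear). Qed.

(** The cross relation: read as an identity in g, it is T f(z) = (s f)(z) T + h(z) with h = T f - k
    s f. *)
Lemma dlopM f g :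
  dlop (f * g) = sg f * dlop g + (dlop f - k *: sg f) * g.
Proof. by rewrite /dlop ddiffM !scaleC; ring. Qed.

Lemma dlop1 : dlop 1 = k *: 1.
Proof. by rewrite /dlop ddiff1 mulr0 scaler0 addr0. Qed.

Let ddiffN : ddiff N = sg N - (1 + C k * C k).
Proof. by rewrite -CM -C1 -CD; apply: d_inj; rewrite ddiffE (dem_num H). Qed.

(* [ddiff N = sg N - (1 + k^2)] is what makes the Hecke relation hold. *)
Lemma dlop_quadratic f : dlop (dlop f) = (k - k^-1) *: dlop f + f.
Proof.
rewrite {2}/dlop dlopD !dlopZ dlopM /dlop ddiff_idem ddiffN.
rewrite !scaleC CB.
move: (ddiff f) (sg N) (C k) (C k^-1) kK => g n K L KL.
apply: subr0_eq; transitivity ((K * L - 1) * (f - K * L * N * g)).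
  by ring.
by rewrite KL subrr mul0r.
Qed.

Lemma dlinvK : cancel dlinv dlop.
Proof.
move=> f; rewrite /dlinv -scaleNr dlopD dlopZ dlop_quadratic.
by rewrite scaleNr addrC addKr.
Qed.

Lemma dlopK : cancel dlop dlinv.
Proof.
by move=> f; rewrite /dlinv dlop_quadratic addrAC subrr add0r.
Qed.

Lemma opinv_dlop : opinv dlop = dlinv.
Proof. exact: (opinvE dlopK dlinvK). Qed.

Lemma leval_dlop f c : c != 0 -> leval N c = 0 ->
  leval (dlop f) c = k * leval f c.
Proof.
by move=> c0 Nc; rewrite /dlop levalD !levalZ levalM // Nc mul0r mulr0 addr0.
Qed.

(** The eigenvalue equation says N D f = 0, and cancelling N leaves D f = 0. *)
Lemma dlop_eigen_fixed f : injective ( *%R N) -> dlop f = k *: f -> sg f = f.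
Proof.
move=> N_inj /eqP; rewrite -subr_eq0 /dlop addrC addKr scaler_eq0 invr_eq0.
rewrite (negPf (dem_k H)) /= => /eqP ND0.
apply: subr0_eq; rewrite -ddiffE.
by rewrite (N_inj (ddiff f) 0) ?mulr0.
Qed.

End DemazureLusztig.

(* The shape shared by [T1] (where [w] is x) and [T0] (where [w] is
   q^(1/2) x^-1). *)
Section AskeyWilsonDatum.
Variables (F : fieldType) (a k u : F) (w w' : laurent F).
Hypotheses (a0 : a != 0) (k0 : k != 0) (u0 : u != 0).
Hypotheses (ww' : w * w' = 1) (sw : lrefl a w = w').
Hypothesis wreg : injective ( *%R (1 - w ^+ 2)).
Hypothesis xw : exists b c, lmon F 1 = b *: w + c *: w'.
Hypothesis xVw : exists b c, lmon F (-1) = b *: w + c *: w'.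

(** From w w' = 1 one gets d w' = w' - w, which supplies the quotients for x and x^-1, both
    combinations of w and w'. *)
Lemma demazure_datum_AW :
  demazure_datum (lrefl a) (1 - w ^+ 2)
    ((1 - (k * u) *: w) * (1 + (k * u^-1) *: w)) k.
Proof.
have sM := lreflM a0; have sK := lreflK a0.
have sD (f g : laurent F) : lrefl a (f + g) = lrefl a f + lrefl a g.
  exact: linearD.
have sB (f g : laurent F) : lrefl a (f - g) = lrefl a f - lrefl a g.
  exact: linearB.
have sZ (c : F) (f : laurent F) : lrefl a (c *: f) = c *: lrefl a f.
  exact: linearZZ.
have sw' : lrefl a w' = w by rewrite -sw sK.
have s1 : lrefl a 1 = 1 by rewrite -lmon0 lrefl_mon expr0z scale1r oppr0.
have dvd (f : laurent F) : (exists b c, f = b *: w + c *: w') ->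
    exists h, (1 - w ^+ 2) * h = lrefl a f - f.
  move=> [b [c ->]]; exists ((b - c) *: w').
  have dw' : (1 - w ^+ 2) * w' = w' - w.
    by rewrite mulrBl mul1r expr2 -mulrA ww' mulr1.
  rewrite -scalerAr dw' sD !sZ sw sw' scalerBl !scalerBr.
  by move: (b *: w) (b *: w') (c *: w) (c *: w') => ? ? ? ?; ring.
split=> //; [exact: dvd|exact: dvd| |].
  rewrite /= sB s1 expr2 sM sw subKr.
  transitivity (w ^+ 2 - (w * w') ^+ 2); first by ring.
  by rewrite ww' expr1n opprB.
pose K := k%:A : laurent F; pose U := u%:A : laurent F.
pose V := u^-1%:A : laurent F.
have UV : U * V = 1 by rewrite -lconstM mulfV // scale1r.
have kkE : (1 + k ^+ 2)%:A = 1 + K * K :> laurent F.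
  by rewrite scalerDl scale1r expr2 lconstM.
have scE (c e : F) (f : laurent F) : (c * e) *: f = c%:A * e%:A * f.
  by rewrite lscaleE lconstM.
rewrite /= sM sB sD s1 !sZ sw !scE kkE -/K -/U -/V.
apply: subr0_eq.
(* The difference of the two sides lies in the ideal generated by w w' - 1 and U V - 1; these are
   explicit coefficients. *)
transitivity ((K * (V - U) * w - K ^+ 2 * (1 + w * w')) * (w * w' - 1)
  + K ^+ 2 * (w ^+ 2 - w ^+ 2 * w' ^+ 2) * (U * V - 1)).
  by ring.
have ww'1 : w * w' - 1 = 0 by rewrite ww' subrr.
have UV1 : U * V - 1 = 0 by rewrite UV subrr.
by rewrite ww'1 UV1 mulr0 mulr0 addr0.
Qed.

End AskeyWilsonDatum.

(** * The operators of the Hecke algebra *)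
Section MultiplicationOperators.
Variable F : fieldType.
Implicit Types f g : laurent F.

Lemma mulop_linear f : linear (mulop f).
Proof. by move=> a g h; rewrite /mulop mulrDr scalerAr. Qed.

Lemma mulopZ a f : mulop (a *: f) = a \*: mulop f.
Proof. by apply/funext => g; rewrite /mulop -scalerAl. Qed.

Lemma mulopD f g : mulop (f + g) = mulop f \+ mulop g.
Proof. by apply/funext => h; rewrite /mulop mulrDl. Qed.

Lemma mulopM f g : mulop (f * g) = mulop f \o mulop g.
Proof. by apply/funext => h; rewrite /mulop /= mulrA. Qed.

End MultiplicationOperators.

(** * Inverses, cross relations and evaluation for [T0] and [T1] *)

Section HeckeOperators.
Variables (F : fieldType) (q s : F) (t : params F).
Hypotheses (q0 : q != 0) (sq : s ^+ 2 = q).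
Hypothesis t0 : [/\ k0 t != 0, k1 t != 0, u0 t != 0 & u1 t != 0].
Implicit Types (f g : laurent F) (X : laurent F -> laurent F).

Local Notation x := (lmon F 1).
Local Notation xV := (lmon F (-1)).

Let N1 := (1 - (k1 t * u1 t) *: x) * (1 + (k1 t * (u1 t)^-1) *: x).
Let N0 := (1 - (s * k0 t * u0 t) *: xV) * (1 + (s * k0 t * (u0 t)^-1) *: xV).

Let d1_reg : injective ( *%R (1 - x ^+ 2)).
Proof.
by rewrite expr2 -lmonD -[lmon F (1 + 1)]scale1r; apply: lmonB1_reg.
Qed.

Let s0 : s != 0.
Proof. by apply: contra_neq q0 => s_eq0; rewrite -sq s_eq0 expr0n. Qed.

Let d0E : 1 - q *: xV ^+ 2 = 1 - (s *: xV) ^+ 2.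
Proof. by rewrite exprZn sq. Qed.

Lemma demazure_datum1 : demazure_datum (lrefl 1) (1 - x ^+ 2) N1 (k1 t).
Proof.
have [_ k10 _ u10] := t0.
apply: (demazure_datum_AW (w' := xV)) => //; first exact: oner_neq0.
- exact: lmon_xV.
- by rewrite lrefl_mon exp1rz scale1r.
- by exists 1, 0; rewrite scale1r scale0r addr0.
- by exists 0, 1; rewrite scale1r scale0r add0r.
Qed.

Lemma demazure_datum0 :
  demazure_datum (lrefl q) (1 - q *: xV ^+ 2) N0 (k0 t).
Proof.
have [k00 _ u00 _] := t0.
have -> : N0 = (1 - (k0 t * u0 t) *: (s *: xV))
               * (1 + (k0 t * (u0 t)^-1) *: (s *: xV)).
  by rewrite /N0 !scalerA ![_ * s]mulrC !mulrA.
rewrite d0E.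
(* Here w = s x^-1, and w' = s^-1 x is its image under x -> q x^-1 because s^2 = q. *)
apply: (@demazure_datum_AW F q (k0 t) (u0 t) (s *: xV) (s^-1 *: x)).
- exact: q0.
- exact: k00.
- exact: u00.
- by rewrite -scalerAl -scalerAr scalerA mulfV // scale1r mulrC lmon_xV.
- rewrite linearZ /= lrefl_mon scalerA opprK; congr (_ *: _).
  by rewrite exprN1 -sq expr2 invfM mulVKf.
- by rewrite -d0E expr2 -lmonD; apply: lmonB1_reg.
- by exists 0, s; rewrite scale0r add0r scalerA mulfV // scale1r.
- by exists s^-1, 0; rewrite scale0r addr0 scalerA mulVf // scale1r.
Qed.

Let T1E : T1 t = dlop (lrefl 1) (1 - x ^+ 2) N1 (k1 t). Proof. by []. Qed.
Let T0E : T0 q s t = dlop (lrefl q) (1 - q *: xV ^+ 2) N0 (k0 t).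
Proof.
by rewrite /T0 /dlop /ddiff /N0; apply/funext => f; congr (_ + _ *: (_ * _)).
Qed.

Lemma T1K : cancel (T1 t) (opinv (T1 t)).
Proof.
by rewrite T1E (opinv_dlop demazure_datum1); apply: dlopK demazure_datum1.
Qed.

Lemma T1VK : cancel (opinv (T1 t)) (T1 t).
Proof.
by rewrite T1E (opinv_dlop demazure_datum1); apply: dlinvK demazure_datum1.
Qed.

Lemma T0K : cancel (T0 q s t) (opinv (T0 q s t)).
Proof.
by rewrite T0E (opinv_dlop demazure_datum0); apply: dlopK demazure_datum0.
Qed.

Local Notation H := (hecke q s t).

(** By the quadratic relation the inverse is [T1] minus a scalar. *)
Lemma hecke_T1V : H (opinv (T1 t)).
Proof.
rewrite (_ : opinv _ = T1 t \+ (- (k1 t - (k1 t)^-1)) \*: idfun).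
  by apply: hecke_add; [exact: hecke_T1|apply: hecke_scale; exact: hecke_id].
rewrite T1E (opinv_dlop demazure_datum1).
by apply/funext => f; rewrite /dlinv -(scaleNr (_ - _)).
Qed.

Lemma hecke_T0V : H (opinv (T0 q s t)).
Proof.
rewrite (_ : opinv _ = T0 q s t \+ (- (k0 t - (k0 t)^-1)) \*: idfun).
  by apply: hecke_add; [exact: hecke_T0|apply: hecke_scale; exact: hecke_id].
rewrite T0E (opinv_dlop demazure_datum0).
by apply/funext => f; rewrite /dlinv -(scaleNr (_ - _)).
Qed.

Lemma hecke_mulop f : H (mulop f).
Proof.
elim/laurent_alg_ind: f => [||a f Hf|f g Hf Hg|f g Hf Hg].
- exact: hecke_z.
- exact: hecke_zV.
- by rewrite mulopZ; apply: hecke_scale.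
- by rewrite mulopD; apply: hecke_add.
- by rewrite mulopM; apply: hecke_comp.
Qed.

Lemma hecke_linear X : H X -> linear X.
Proof.
elim=> {X} [||||| X X' _ lX _ lX'|a X _ lX|X X' _ lX _ lX'].
- exact: (dlop_linear demazure_datum0).
- exact: (dlop_linear demazure_datum1).
- exact: mulop_linear.
- exact: mulop_linear.
- by [].
- by move=> a f g /=; rewrite lX lX' scalerDr addrACA.
- by move=> b f g /=; rewrite lX scalerDr !scalerA mulrC.
- by move=> a f g /=; rewrite lX' lX.
Qed.

Lemma T1_one : T1 t 1 = k1 t *: 1.
Proof. exact: (dlop1 demazure_datum1). Qed.

Lemma T0_one : T0 q s t 1 = k0 t *: 1.
Proof. exact: (dlop1 demazure_datum0). Qed.

Lemma Y_one : Y q s t 1 = gammap q t 0 *: 1.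
Proof.
rewrite /Y /= T0_one (linear_scale _ _ (hecke_linear (hecke_T1 _ _ _))).
by rewrite T1_one scalerA /gammap expr1z expr0z mulr1.
Qed.

Lemma T1_mulop g : exists h,
  T1 t \o mulop g = (mulop (lrefl 1 g) \o T1 t) \+ mulop h.
Proof. by eexists; apply/funext => f; apply: (dlopM demazure_datum1). Qed.

Lemma T0_mulop g : exists h,
  T0 q s t \o mulop g = (mulop (lrefl q g) \o T0 q s t) \+ mulop h.
Proof. by eexists; apply/funext => f; apply: (dlopM demazure_datum0). Qed.

(** The numerator can be cancelled: it is a product of two factors 1 - a x, each injective as a
    multiplier. *)
Lemma T1_eigen_lsymmetric f : T1 t f = k1 t *: f -> lsymmetric f.
Proof.
apply: (dlop_eigen_fixed demazure_datum1) => g h.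
rewrite /= /N1 -!mulrA => /(lmonB1_reg (m := 1) isT).
by rewrite -[_ *: x]opprK -scaleNr => /(lmonB1_reg (m := 1) isT).
Qed.

Let c0 : (k1 t)^-1 * (u1 t)^-1 != 0.
Proof. by have [_ k10 _ u10] := t0; rewrite mulf_neq0 ?invr_eq0. Qed.

(** The evaluation point (k1 u1)^-1 is a zero of the first factor of the numerator, so only the
    scalar term survives. *)
Lemma Ev_T1 X : Ev t (T1 t \o X) = k1 t * Ev t X.
Proof.
have [_ k10 _ u10] := t0.
rewrite /Ev /= T1E leval_dlop; [by []|exact: c0|rewrite /N1].
rewrite levalM // levalD -scaleNr levalZ leval1 leval_mon expr1z mulNr.
by rewrite -invfM mulfV ?mulf_neq0 // subrr mul0r.
Qed.

(** x^-1 takes the value k1 u1 at the evaluation point, and T1^-1 contributes k1^-1 by [Ev_T1]. *)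
Lemma Ev_T1v X : Ev t (T1v t \o X) = u1 t * Ev t X.
Proof.
have [_ k10 _ u10] := t0.
rewrite -[in RHS](_ : T1 t \o (opinv (T1 t) \o X) = X).
  rewrite Ev_T1 /Ev /= /T1v /= /zV /mulop levalM // leval_mon.
  by rewrite -[(_ * _) ^ -1]/((_ * _)^-1) invfM !invrK; ring.
by apply/funext => f /=; rewrite T1VK.
Qed.

End HeckeOperators.

(** * The duality anti-isomorphism *)
Section Spectral.
Variables (F : fieldType) (q s : F) (t : params F).
Implicit Types (f g p : laurent F) (X : laurent F -> laurent F).

(* [X] behaves as f(Y^-1), as far as eigenvectors of [Y] are concerned. *)
Definition spectral f X : Prop :=
  linear X /\ forall p c, c != 0 -> Y q s t p = c *: p ->
                          X p = leval f c^-1 *: p.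

Lemma spectral_add f g X X' :
  spectral f X -> spectral g X' -> spectral (f + g) (X \+ X').
Proof.
move=> [lX sX] [lX' sX']; split=> [a u v /=|p c c0 Yp /=].
  by rewrite lX lX' scalerDr addrACA.
by rewrite (sX _ _ c0 Yp) (sX' _ _ c0 Yp) levalD scalerDl.
Qed.

Lemma spectral_scale a f X : spectral f X -> spectral (a *: f) (a \*: X).
Proof.
move=> [lX sX]; split=> [b u v /=|p c c0 Yp /=].
  by rewrite lX scalerDr !scalerA mulrC.
by rewrite (sX _ _ c0 Yp) levalZ scalerA.
Qed.

(** The operators are composed in reverse order to match the antihomomorphism [nu]. *)
Lemma spectral_comp f g X X' :
  spectral f X -> spectral g X' -> spectral (f * g) (X' \o X).
Proof.
move=> [lX sX] [lX' sX']; split=> [b u v /=|p c c0 Yp /=].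
  by rewrite lX lX'.
rewrite (sX _ _ c0 Yp) (linear_scale _ _ lX') (sX' _ _ c0 Yp) scalerA.
by rewrite levalM ?invr_eq0.
Qed.

Lemma spectral_Y : linear (Y q s t) -> spectral (lmon F (-1)) (Y q s t).
Proof. by move=> lY; split=> // p c c0 ->; rewrite leval_mon exprN1 invrK. Qed.

Lemma spectral_YV X :
  linear X -> cancel (Y q s t) X -> spectral (lmon F 1) X.
Proof.
move=> lX YK; split=> // p c c0 Yp; rewrite leval_mon expr1z.
by rewrite -{2}(YK p) Yp (linear_scale _ _ lX) scalerA mulVf // scale1r.
Qed.

(** The eigenvalues may differ, but f agrees at both and, being symmetric, at their inverses; so one
    scalar serves the whole span. *)
Lemma spectral_sum f X p p' c c' a b : spectral f X -> lsymmetric f ->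
  c != 0 -> c' != 0 -> leval f c' = leval f c ->
  Y q s t p = c *: p -> Y q s t p' = c' *: p' ->
  X (a *: p + b *: p') = leval f c *: (a *: p + b *: p').
Proof.
move=> [lX sX] fsym c0 c'0 fc' Yp Yp'.
rewrite lX (linear_scale _ _ lX) (sX _ _ c0 Yp) (sX _ _ c'0 Yp').
rewrite !(leval_lsymmetric _ fsym) fc' scalerDr !scalerA.
by rewrite ![_ * leval _ _]mulrC.
Qed.

End Spectral.

(** * The duality map on f(z) and on functions of Y *)

Section Duality.
Variables (F : fieldType) (q s : F) (t : params F).
Variable nu : (laurent F -> laurent F) -> laurent F -> laurent F.
Hypotheses (q0 : q != 0) (sq : s ^+ 2 = q).
Hypothesis t0 : [/\ k0 t != 0, k1 t != 0, u0 t != 0 & u1 t != 0].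
Hypothesis nuP : duality_antiiso q s t nu.
Implicit Types (f g p : laurent F) (X : laurent F -> laurent F).

Local Notation H := (hecke q s t).
Local Notation H' := (hecke q s (dual t)).

Let t'0 : [/\ k0 (dual t) != 0, k1 (dual t) != 0,
              u0 (dual t) != 0 & u1 (dual t) != 0].
Proof. by have [] := t0. Qed.

Let nu_hecke X : H X -> H' (nu X).
Proof. by have [[[homo_nu _ _] _ _ _ _] _] := nuP; apply: homo_nu. Qed.

Let nuD X X' : H X -> H X' -> nu (X \+ X') = nu X \+ nu X'.
Proof. by have [[_ + _ _ _] _] := nuP; apply. Qed.

Let nuZ a X : H X -> nu (a \*: X) = a \*: nu X.
Proof. by have [[_ _ + _ _] _] := nuP; apply. Qed.

Let nu_id : nu idfun = idfun.
Proof. by have [[_ _ _ + _] _] := nuP. Qed.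

Let nuM X X' : H X -> H X' -> nu (X \o X') = nu X' \o nu X.
Proof. by have [[_ _ _ _ +] _] := nuP; apply. Qed.

Let nuT0 : nu (T0 q s t) = T1v (dual t). Proof. by have [_ []] := nuP. Qed.
Let nuT1 : nu (T1 t) = T1 (dual t). Proof. by have [_ []] := nuP. Qed.
Let nuT1v : nu (T1v t) = T0 q s (dual t). Proof. by have [_ []] := nuP. Qed.

Let hT0 : H (T0 q s t). Proof. exact: hecke_T0. Qed.
Let hT1 : H (T1 t). Proof. exact: hecke_T1. Qed.
Let hY : H (Y q s t). Proof. exact: hecke_comp. Qed.
Let hz : H (@z F). Proof. exact: hecke_z. Qed.
Let hzV : H (@zV F). Proof. exact: hecke_zV. Qed.

Let T1v_T1 : T1v t \o T1 t = @zV F.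
Proof. by apply/funext => f; rewrite /T1v /= (T1K t0). Qed.

Let zVz : @zV F \o @z F = idfun.
Proof.
apply/funext => f; rewrite /z /zV /mulop /= mulrA (mulrC (lmon F (-1))).
by rewrite lmon_xV mul1r.
Qed.

Let zzV : @z F \o @zV F = idfun.
Proof. by apply/funext => f; rewrite /z /zV /mulop /= mulrA lmon_xV mul1r. Qed.

Let hT1v : H (T1v t).
Proof. by apply: hecke_comp; [exact: hzV|exact: hecke_T1V]. Qed.

(** z^-1 = T1v T1, and [nu] reverses this into T1 T0 for the dual parameters. *)
Lemma nu_zV : nu (@zV F) = Y q s (dual t).
Proof. rewrite -T1v_T1 (nuM hT1v hT1) nuT1 nuT1v; reflexivity. Qed.

Lemma nu_Y : nu (Y q s t) = @zV F.
Proof.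
rewrite /Y (nuM hT1 hT0).
transitivity (T1v (dual t) \o T1 (dual t)).
  by congr (_ \o _); [exact: nuT0|exact: nuT1].
by apply/funext => f; rewrite /T1v /= (T1K t'0).
Qed.

(** [nu] sends z^-1 to the dual Y, hence z to a left inverse of it; sums and products follow. *)
Lemma nu_mulop_spectral f : spectral q s (dual t) f (nu (mulop f)).
Proof.
have hm := hecke_mulop q s t.
elim/laurent_alg_ind: f => [||a f Hf|f g Hf Hg|f g Hf Hg].
- apply: spectral_YV; first exact: (hecke_linear q0 sq t'0 (nu_hecke hz)).
  move=> p; have := congr1 (@^~ p) (nuM hzV hz).
  by rewrite zVz nu_id nu_zV /= => <-.
- by rewrite [nu _]nu_zV; apply/spectral_Y/(hecke_linear q0 sq t'0)/hecke_comp;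
    [exact: hecke_T1|exact: hecke_T0].
- by rewrite mulopZ (nuZ _ (hm f)); apply: spectral_scale.
- by rewrite mulopD (nuD (hm f) (hm g)); apply: spectral_add.
- by rewrite mulopM (nuM (hm f) (hm g)); apply: spectral_comp.
Qed.

(** The element is f(Y^-1), built from Y and T0^-1 T1^-1; [nu] turns it into f(z) because it sends Y
    to z^-1. *)
Lemma spectral_preimage f :
  exists X, [/\ H X, nu X = mulop f & spectral q s t f X].
Proof.
elim/laurent_alg_ind: f => [||a f [X [hX nX sX]]
  |f g [X [hX nX sX]] [X' [hX' nX' sX']]
  |f g [X [hX nX sX]] [X' [hX' nX' sX']]].
- pose YV := opinv (T0 q s t) \o opinv (T1 t).
  have hYV : H YV by apply: hecke_comp; [exact: hecke_T0V|exact: hecke_T1V].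
  have YK : cancel (Y q s t) YV by exact: can_comp (T1K t0) (T0K q0 sq t0).
  exists YV; split; [exact: hYV| |].
    (* z^-1 nu(YV) = nu(Y) nu(YV) = nu(YV Y) = 1, so nu(YV) = z. *)
    apply/funext => p; have := congr1 (@^~ (nu YV p)) zzV.
    rewrite /= => <-; congr (z _).
    rewrite -nu_Y -[LHS]/((nu (Y q s t) \o nu YV) p) -(nuM hYV hY).
    rewrite (_ : YV \o Y q s t = idfun) ?nu_id //.
    by apply/funext => g /=; rewrite YK.
  by apply: spectral_YV; [exact: (hecke_linear q0 sq t0 hYV)|exact: YK].
- exists (Y q s t); split; [exact: hY|exact: nu_Y|].
  by apply: spectral_Y; apply: (hecke_linear q0 sq t0).
- exists (a \*: X); split; [exact: hecke_scale| |exact: spectral_scale].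
  by rewrite (nuZ _ hX) nX mulopZ.
- exists (X \+ X'); split; [exact: hecke_add| |exact: spectral_add].
  by rewrite (nuD hX hX') nX nX' mulopD.
- exists (X' \o X); split; [exact: hecke_comp| |exact: spectral_comp].
  by rewrite (nuM hX' hX) nX nX' mulopM.
Qed.

(** * Normal forms and invariance of the evaluation under duality *)

Inductive T_word : (laurent F -> laurent F) -> Prop :=
| T_word_id : T_word idfun
| T_word_T0 X : T_word X -> T_word (T0 q s t \o X)
| T_word_T1 X : T_word X -> T_word (T1 t \o X).

(** The span of the products g(z) W; scalars are absorbed into g, so sums suffice. *)
Inductive normal_form : (laurent F -> laurent F) -> Prop :=
| normal_form_word g X : T_word X -> normal_form (mulop g \o X)
| normal_form_add X X' : normal_form X -> normal_form X' ->
    normal_form (X \+ X').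

(** The induction shows that left multiplication by X preserves normal forms; applying this to the
    identity gives the claim. *)
Lemma normal_form_hecke X : H X -> normal_form X.
Proof.
suff hX_nf : H X -> forall V, normal_form V -> normal_form (X \o V).
  move=> hX; rewrite -[X]/(X \o idfun); apply: hX_nf => //.
  rewrite (_ : idfun = mulop 1 \o idfun).
    exact: normal_form_word T_word_id.
  by apply/funext => f; rewrite /mulop /= mul1r.
have nf_comp (X1 V1 V2 : laurent F -> laurent F) : linear X1 ->
    X1 \o (V1 \+ V2) = (X1 \o V1) \+ (X1 \o V2).
  by move=> lX; apply/funext => f /=; rewrite -[V1 f]scale1r lX !scale1r.
have nf_mulop g V : normal_form V -> normal_form (mulop g \o V).
  elim=> {V} [h V wV|V V' _ IH _ IH'].
    by rewrite -[_ \o _]/((mulop g \o mulop h) \o V) -mulopM;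
      apply: normal_form_word.
  rewrite nf_comp; last exact: mulop_linear.
  exact: normal_form_add.
have nf_T (T sg : laurent F -> laurent F) V :
    linear T -> (forall W, T_word W -> T_word (T \o W)) ->
    (forall g, exists h, T \o mulop g = (mulop (sg g) \o T) \+ mulop h) ->
    normal_form V -> normal_form (T \o V).
  move=> lT wT Tg; elim=> {V} [g W wW|V V' _ IH _ IH'].
    (* Moving T past g(z) leaves one term with the longer word T W and one with W itself. *)
    have [h Th] := Tg g.
    rewrite -[_ \o _]/((T \o mulop g) \o W) Th.
    rewrite -[_ \o _]/((mulop (sg g) \o (T \o W)) \+ (mulop h \o W)).
    by apply: normal_form_add; apply: normal_form_word => //; apply: wT.
  by rewrite nf_comp //; apply: normal_form_add.
elim=> {X} [||||| X X' _ nX _ nX'|a X hX nX|X X' _ nX _ nX'] V nV.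
- apply: nf_T nV; last exact: (T0_mulop q0 sq t0).
    exact: (hecke_linear q0 sq t0 hT0).
  exact: T_word_T0.
- apply: nf_T nV; last exact: (T1_mulop t0).
    exact: (hecke_linear q0 sq t0 hT1).
  exact: T_word_T1.
- exact: nf_mulop.
- exact: nf_mulop.
- exact: nV.
- by rewrite -[_ \o _]/((X \o V) \+ (X' \o V)); apply: normal_form_add; auto.
- rewrite (_ : _ \o _ = mulop a%:A \o (X \o V)); first by apply: nf_mulop; auto.
  by apply/funext => f; rewrite /mulop /= lscaleE.
- by rewrite -[_ \o _]/(X \o (X' \o V)); auto.
Qed.

Lemma T_word_hecke X : T_word X -> H X.
Proof. by elim=> [|W _ hW|W _ hW]; [exact: hecke_id|exact: hecke_comp..]. Qed.

(** The scalar is the product of the k0 and k1 of the letters: [nu] sends T0 to T1v, whose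
    evaluation scalar is u1 of the dual parameters, that is k0. The free V absorbs letters as [nu]
    reverses the word. *)
Lemma T_word_Ev X : T_word X ->
  exists c, X 1 = c *: 1 /\
            forall V, Ev (dual t) (nu X \o V) = c * Ev (dual t) V.
Proof.
elim=> {X} [|X wX [c [X1 nX]]|X wX [c [X1 nX]]].
- by exists 1; rewrite scale1r; split=> // V; rewrite nu_id mul1r.
- exists (c * k0 t); split=> [/=|V].
    rewrite X1 (linear_scale _ _ (hecke_linear q0 sq t0 hT0)).
    by rewrite (T0_one q0 sq t0) scalerA.
  rewrite (nuM hT0 (T_word_hecke wX)).
  by rewrite -[_ \o _]/(nu X \o (_ \o V)) nX nuT0 (Ev_T1v t'0) mulrA.
- exists (c * k1 t); split=> [/=|V].
    rewrite X1 (linear_scale _ _ (hecke_linear q0 sq t0 hT1)).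
    by rewrite (T1_one t0) scalerA.
  rewrite (nuM hT1 (T_word_hecke wX)).
  by rewrite -[_ \o _]/(nu X \o (_ \o V)) nX nuT1 (Ev_T1 t'0) mulrA.
Qed.

Lemma xp0E : (xp q t 0)^-1 = (k1 t)^-1 * (u1 t)^-1.
Proof. by rewrite /xp expr1z expr0z mulr1 invfM. Qed.

Lemma gammap_dual m : gammap q (dual t) m = xp q t m.
Proof. by rewrite /gammap /xp /= (mulrC (u1 t)). Qed.

Lemma xp_dual m : xp q (dual t) m = gammap q t m.
Proof. by rewrite /gammap /xp /= (mulrC (k1 t)). Qed.

Lemma xp_neq0 m : xp q t m != 0.
Proof.
have [_ k10 _ u10] := t0.
by apply: mulf_neq0; apply: expfz_neq0; [exact: mulf_neq0|exact: q0].
Qed.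

(** 1 is an eigenvector of the dual Y with eigenvalue x_0, so nu(g(z)) contributes g(x_0^-1), the
    value that Ev takes on g(z). Membership in [hecke] is carried along because [nu] respects sums
    there. *)
Lemma normal_form_Ev X : normal_form X -> H X /\ Ev (dual t) (nu X) = Ev t X.
Proof.
elim=> {X} [g X wX|X X' _ [hX nX] _ [hX' nX']]; last first.
  split; first exact: hecke_add.
  rewrite (nuD hX hX') [LHS]levalD [RHS]levalD.
  by congr (_ + _); [exact: nX|exact: nX'].
have hX := T_word_hecke wX; have hg := hecke_mulop q s t g.
split; first exact: hecke_comp.
have [c [X1 nuX]] := T_word_Ev wX.
have [_ sg] := nu_mulop_spectral g.
rewrite (nuM hg hX) nuX /Ev /= X1 (linear_scale c 1 (mulop_linear g)).
rewrite [mulop g 1]mulr1 levalZ.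
rewrite (sg 1 (gammap q (dual t) 0)); last exact: (Y_one q0 sq t'0).
  by rewrite gammap_dual xp0E levalZ leval1 mulr1.
by rewrite gammap_dual xp_neq0.
Qed.

Lemma Ev_nu X : H X -> Ev (dual t) (nu X) = Ev t X.
Proof. by move/normal_form_hecke/normal_form_Ev => []. Qed.

(** If nu(X) = f(z), the pairing evaluates nu(X p(z)), and [Ev_nu] turns this into the evaluation of
    X p(z). *)
Lemma pairing_spectral f : exists2 X, spectral q s t f X &
  forall p, pairing (dual t) nu (mulop f) (mulop p) = leval (X p) (xp q t 0)^-1.
Proof.
have [X [hX nX sX]] := spectral_preimage f; exists X => // p.
have hp := hecke_mulop q s t p.
rewrite /pairing -nX -(nuM hX hp) Ev_nu; last exact: hecke_comp.
by rewrite /Ev /= /mulop mulr1 xp0E.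
Qed.

End Duality.

(** * Evaluation of the renormalized polynomials *)
Section Evaluation.
Variables (F : fieldType) (q s : F).
Implicit Types (t : params F) (f g p : laurent F) (m n : int).

(** [eps] is odd away from 0; at 0 it is 1, and gamma_0 need not be its own inverse. *)
Lemma gammap_opp t m : m != 0 -> gammap q t (- m) = (gammap q t m)^-1.
Proof.
move=> m0; have eps_opp : eps (- m) = - eps m.
  by rewrite /eps oppr_ge0; case: ltgtP m0 => // _; rewrite opprK.
by rewrite /gammap eps_opp invfM !invr_expz.
Qed.

Lemma leval_gammap_opp t f m : lsymmetric f ->
  leval f (gammap q t (- m)) = leval f (gammap q t m).
Proof.
move=> fsym; have [->|m0] := eqVneq m 0; first by rewrite oppr0.
by rewrite gammap_opp // leval_lsymmetric.
Qed.

(** This lets the symmetric family, indexed by natural numbers, serve every integer m. *)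
Lemma leval_gammap_abs t f m : lsymmetric f ->
  leval f (gammap q t `|m|%N) = leval f (gammap q t m).
Proof.
by move=> fsym; case: m => n //; rewrite NegzE abszN leval_gammap_opp.
Qed.

Lemma gammap_neq0 t m : q != 0 -> k0 t != 0 -> k1 t != 0 -> gammap q t m != 0.
Proof.
by move=> q0 k00 k10; apply: mulf_neq0; apply: expfz_neq0; rewrite ?mulf_neq0.
Qed.

Lemma leval_renorm c p : leval p c != 0 -> leval (renorm c p) c = 1.
Proof. by move=> pc; rewrite /renorm levalZ mulVf. Qed.

Lemma lsymmetric_scale a p : lsymmetric p -> lsymmetric (a *: p).
Proof. by rewrite /lsymmetric => {2}<-; exact: linearZZ. Qed.

Lemma spectral_P t f X P m : q != 0 -> k0 t != 0 -> k1 t != 0 ->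
  spectral q s t f X -> is_P q s t m (P m) ->
  forall a, X (a *: P m) = leval f (gammap q t m)^-1 *: (a *: P m).
Proof.
move=> q0 k00 k10 [lX sX] [_ YP] a.
rewrite (linear_scale _ _ lX) (sX _ _ (gammap_neq0 m q0 k00 k10) YP).
by rewrite !scalerA mulrC.
Qed.

Lemma spectral_Pplus t f X P (n : nat) p : q != 0 -> k0 t != 0 -> k1 t != 0 ->
  spectral q s t f X -> lsymmetric f -> (forall m, is_P q s t m (P m)) ->
  is_Pplus t P n p ->
  forall a, X (a *: p) = leval f (gammap q t n) *: (a *: p).
Proof.
move=> q0 k00 k10 sX fsym hP [[b [c ->]] _ _] a.
rewrite scalerDr !scalerA.
apply: (spectral_sum _ _ sX fsym _ _ _ (hP _).2 (hP _).2).
- exact: gammap_neq0.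
- exact: gammap_neq0.
- exact: leval_gammap_opp.
Qed.

(** Only one of the two pairings is treated; exchanging the parameters with their duals yields the
    other. *)
Lemma duality_half t nu (P P' : int -> laurent F) (Pp Pp' : nat -> laurent F)
    (x := xp q t) (gamma := gammap q t)
    (E := fun m => renorm (x 0)^-1 (P m))
    (E' := fun m => renorm (gamma 0)^-1 (P' m))
    (Ep := fun m => renorm (x 0) (Pp `|m|%N))
    (Ep' := fun m => renorm (gamma 0) (Pp' `|m|%N))
    (B := pairing (dual t) nu) :
  q != 0 -> s ^+ 2 = q ->
  [/\ k0 t != 0, k1 t != 0, u0 t != 0 & u1 t != 0] ->
  duality_antiiso q s t nu ->
  (forall m, is_P q s t m (P m)) -> (forall m, is_P q s (dual t) m (P' m)) ->
  (forall n : nat, is_Pplus t P n (Pp n)) ->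
  (forall n : nat, is_Pplus (dual t) P' n (Pp' n)) ->
  (forall m, leval (P m) (x 0)^-1 != 0) ->
  (forall m, leval (P' m) (gamma 0)^-1 != 0) ->
  (forall n : nat, leval (Pp n) (x 0) != 0) ->
  (forall n : nat, leval (Pp' n) (gamma 0) != 0) ->
  [/\ forall m f, leval f (gamma m)^-1 = B (mulop f) (mulop (E m)),
      forall m n, leval (E m) (x n)^-1 = leval (E' n) (gamma m)^-1,
      forall m f, lsymmetric f -> leval f (gamma m) = B (mulop f) (mulop (Ep m))
    & forall m n, leval (Ep m) (x n) = leval (Ep' n) (gamma m)].
Proof.
move=> q0 sq t0 nuP hP hP' hPp hPp' hP0 hP'0 hPp0 hPp'0.
have [k00 k10 u00 u10] := t0.
have t'0 : [/\ k0 (dual t) != 0, k1 (dual t) != 0,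
  u0 (dual t) != 0 & u1 (dual t) != 0] by [].
have BE f m : leval f (gamma m)^-1 = B (mulop f) (mulop (E m)).
  have [X sX BX] := pairing_spectral q0 sq t0 nuP f.
  rewrite /B BX /E (spectral_P q0 k00 k10 sX (hP m)) levalZ.
  by rewrite leval_renorm ?mulr1.
have Ep_sym m : lsymmetric (Ep m).
  have [_ _ T1p] := hPp `|m|%N.
  exact/lsymmetric_scale/(T1_eigen_lsymmetric t0).
have Ep'_sym m : lsymmetric (Ep' m).
  have [_ _ T1p] := hPp' `|m|%N.
  exact/lsymmetric_scale/(T1_eigen_lsymmetric t'0).
have BEp f m : lsymmetric f ->
    leval f (gamma m) = B (mulop f) (mulop (Ep m)).
  move=> fsym; have [X sX BX] := pairing_spectral q0 sq t0 nuP f.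
  have XEp : X (Ep m) = leval f (gamma m) *: Ep m.
    by rewrite -leval_gammap_abs //; apply: spectral_Pplus.
  (* The normalization is at x_0 but the evaluation at x_0^-1; symmetry of [Ep] identifies the two
     values. *)
  rewrite /B BX XEp levalZ (leval_lsymmetric _ (Ep_sym m)).
  by rewrite leval_renorm ?mulr1.
(* The second reading of the pairing: nu(p(z)) acts on f, and the result is evaluated at
   gamma_0^-1. *)
have Bnu f p :
    B (mulop f) (mulop p) = leval (nu (mulop p) f) (gamma 0)^-1.
  rewrite /B /pairing /Ev /= /mulop mulr1 /gamma.
  by rewrite -xp_dual xp0E.
split=> [m f|m n|m f fsym|m n].
- exact: BE.
- rewrite (BE (E' n) m) Bnu.
  have sE := nu_mulop_spectral q0 sq t0 nuP (E m).
  rewrite (spectral_P q0 _ _ sE (hP' n)) // levalZ leval_renorm // mulr1.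
  by rewrite gammap_dual.
- exact: BEp.
- rewrite (BEp (Ep' n) m) // Bnu.
  have sE := nu_mulop_spectral q0 sq t0 nuP (Ep m).
  have nuEp' : nu (mulop (Ep m)) (Ep' n) = leval (Ep m) (x n) *: Ep' n.
    rewrite /x -gammap_dual -leval_gammap_abs //.
    exact: (spectral_Pplus q0 _ _ sE (Ep_sym m) hP' (hPp' _)).
  rewrite nuEp' levalZ (leval_lsymmetric _ (Ep'_sym n)).
  by rewrite leval_renorm ?mulr1.
Qed.

End Evaluation.

Theorem theorem10p7 (R : realType) (q s : R[i]) (t : params R[i])
  (nu nu' : (laurent R[i] -> laurent R[i]) -> (laurent R[i] -> laurent R[i]))
  (P P' : int -> laurent R[i]) (Pp Pp' : nat -> laurent R[i])
  (hq0 : q != 0) (hq1 : `|q| != 1) (hs : s ^+ 2 = q)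
  (ht : generic q t)
  (hnu : duality_antiiso q s t nu)
  (hnu' : duality_antiiso q s (dual t) nu')
  (hP : forall m : int, is_P q s t m (P m))
  (hP' : forall m : int, is_P q s (dual t) m (P' m))
  (hPp : forall m : nat, is_Pplus t P m (Pp m))
  (hPp' : forall m : nat, is_Pplus (dual t) P' m (Pp' m))
  (hP0 : forall m : int, leval (P m) (xp q t 0)^-1 != 0)
  (hP'0 : forall m : int, leval (P' m) (gammap q t 0)^-1 != 0)
  (hPp0 : forall m : nat, leval (Pp m) (xp q t 0) != 0)
  (hPp'0 : forall m : nat, leval (Pp' m) (gammap q t 0) != 0) :
  let gamma := gammap q t in
  let x := xp q t in
  let E m := renorm (x 0)^-1 (P m) in
  let E' m := renorm (gamma 0)^-1 (P' m) in
  let Ep (m : int) := renorm (x 0) (Pp `|m|%N) in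
  let Ep' (m : int) := renorm (gamma 0) (Pp' `|m|%N) in
  let B := pairing t nu' in
  let B' := pairing (dual t) nu in
  ((forall (m : int) (f : laurent R[i]),
      leval f (gamma m)^-1 = B' (mulop f) (mulop (E m))) /\
   (forall (n : int) (f : laurent R[i]),
      leval f (x n)^-1 = B (mulop f) (mulop (E' n))) /\
   (forall m n : int, leval (E m) (x n)^-1 = leval (E' n) (gamma m)^-1)) /\
  ((forall (m : int) (f : laurent R[i]), lsymmetric f ->
      leval f (gamma m) = B' (mulop f) (mulop (Ep m))) /\
   (forall (n : int) (f : laurent R[i]), lsymmetric f ->
      leval f (x n) = B (mulop f) (mulop (Ep' n))) /\
   (forall m n : int, leval (Ep m) (x n) = leval (Ep' n) (gamma m))).
Proof.
move=> gamma x E E' Ep Ep' B B'.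
have t0 := ht.1.
have t'0 : [/\ k0 (dual t) != 0, k1 (dual t) != 0,
  u0 (dual t) != 0 & u1 (dual t) != 0] by case: t0.
have xE : gammap q (dual t) = x by apply/funext => m; exact: gammap_dual.
have ddt : dual (dual t) = t by rewrite /dual; case: (t).
have gammaE : xp q (dual t) = gamma by apply/funext => m; exact: xp_dual.
have [BE dualE BEp dualEp] :=
  duality_half hq0 hs t0 hnu hP hP' hPp hPp' hP0 hP'0 hPp0 hPp'0.
(* The other pairing comes from exchanging t with its dual, since dualizing twice gives t back. *)
have := @duality_half _ q s (dual t) nu' P' P Pp' Pp hq0 hs t'0 hnu' hP'.
rewrite ddt xE gammaE => /(_ hP hPp' hPp hP'0 hP0 hPp'0 hPp0) [BE' _ BEp' _].
split; split; [exact: BE|split|exact: BEp|split].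
- exact: BE'.
- exact: dualE.
- exact: BEp'.
- exact: dualEp.
Qed.
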